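(* Let $A\in\mathbb{C}^{m\times n}$, $0\neq W\in\mathbb{C}^{n\times m}$ and $q\in\mathbb{N}\cup\{0\}$. The system of equations (in the unknown $X\in\mathbb{C}^{m\times n}$) $$XWAWX=X,\qquad XWA=(WAWP_{(AW)^q})^\dagger WA,\qquad AWX=AW(WAWP_{(AW)^q})^\dagger$$ is consistent and has a unique solution, namely $X=(WAWP_{(AW)^q})^\dagger$.
   Context: $B^\dagger$ denotes the Moore-Penrose inverse of a complex matrix $B$. $P_B:=BB^\dagger$ is the orthogonal projector onto the column space of $B$. By convention $(AW)^0=I_m$. *)

(* Defs.v *)
From HB Require Import structures.
From mathcomp Require Import all_boot all_order all_algebra.
From mathcomp Require Import reals complex.

Set Implicit Arguments.
Unset Strict Implicit.
Unset Printing Implicit Defensive.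

Import Order.TTheory GRing.Theory Num.Theory.

Local Open Scope ring_scope.
Local Open Scope sesquilinear_scope.

Definition penrose (C : numClosedFieldType) m n
    (B : 'M[C]_(m, n)) (X : 'M[C]_(n, m)) : bool :=
  [&& B *m X *m B == B, X *m B *m X == X,
      (B *m X)^t* == B *m X & (X *m B)^t* == X *m B].

Lemma trmxC_mul (C : numClosedFieldType) m n p
    (A : 'M[C]_(m, n)) (B : 'M[C]_(n, p)) : (A *m B)^t* = B^t* *m A^t*.
Proof. by rewrite trmx_mul map_mxM. Qed.

Lemma trmxC_inv (C : numClosedFieldType) n (A : 'M[C]_n) :
  (invmx A)^t* = invmx (A^t*).
Proof. by rewrite trmx_inv map_invmx. Qed.

Lemma gram_unit (C : numClosedFieldType) m n (G : 'M[C]_(m, n)) :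
  row_free G -> G *m G^t* \in unitmx.
Proof.
move=> freeG; rewrite -row_free_unit -kermx_eq0; apply/eqP/row_matrixP => i.
rewrite row0; set v := row i _.
have /sub_kermxP v0 : (v <= kermx (G *m G^t*))%MS by apply: row_sub.
apply/eqP; rewrite -(mulmx_free_eq0 v freeG); apply/eqP.
set u := v *m G.
apply: contraTeq isT => /dotmx_is_dotmx; rewrite dotmxE.
by rewrite {2}/u trmxC_mul mulmxA /u -(mulmxA v) v0 mul0mx mxE ltxx.
Qed.

Lemma penrose_factor (C : numClosedFieldType) m r n
    (F : 'M[C]_(m, r)) (G : 'M[C]_(r, n)) :
  row_full F -> row_free G ->
  penrose (F *m G)
    ((G^t* *m invmx (G *m G^t*)) *m (invmx (F^t* *m F) *m F^t*)).
Proof.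
move=> fullF freeG.
have uG : G *m G^t* \in unitmx by apply: gram_unit.
have uF : F^t* *m F \in unitmx.
  have := @gram_unit C _ _ (F^t*); rewrite trmxCK; apply.
  by rewrite /row_free mxrank_map mxrank_tr -/(row_full F).
set K := G^t* *m _; set L := _ *m F^t*.
have LF : L *m F = 1%:M by rewrite /L -mulmxA mulVmx.
have GK : G *m K = 1%:M by rewrite /K mulmxA mulmxV.
have BX : F *m G *m (K *m L) = F *m L by rewrite -mulmxA (mulmxA G) GK mul1mx.
have XB : K *m L *m (F *m G) = K *m G by rewrite -mulmxA (mulmxA L) LF mul1mx.
rewrite /penrose BX XB; apply/and4P; split; apply/eqP.
- by rewrite -mulmxA (mulmxA L) LF mul1mx.
- by rewrite -mulmxA (mulmxA G) GK mul1mx.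
- by rewrite /L !trmxC_mul trmxC_inv trmxC_mul trmxCK mulmxA.
- by rewrite /K !trmxC_mul trmxC_inv trmxC_mul trmxCK mulmxA.
Qed.

Lemma penrose_ex (C : numClosedFieldType) m n (B : 'M[C]_(m, n)) :
  exists X : 'M[C]_(n, m), penrose B X.
Proof.
have := penrose_factor (col_base_full B) (row_base_free B).
by rewrite mulmx_base => PX; eexists; exact: PX.
Qed.

Lemma penrose_uniq (C : numClosedFieldType) m n
    (B : 'M[C]_(m, n)) (X Y : 'M[C]_(n, m)) :
  penrose B X -> penrose B Y -> X = Y.
Proof.
case/and4P=> /eqP X1 /eqP X2 /eqP X3 /eqP X4.
case/and4P=> /eqP Y1 /eqP Y2 /eqP Y3 /eqP Y4.
have e1 : B *m X = B *m Y.
  by rewrite -{1}Y1 -mulmxA -{1}X3 -{1}Y3 -trmxC_mul mulmxA X1.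
have e2 : X *m B = Y *m B.
  by rewrite -{1}Y1 mulmxA mulmxA -(mulmxA _ Y) -{1}X4 -{1}Y4 -trmxC_mul
             -mulmxA (mulmxA B) X1.
by rewrite -X2 e2 -mulmxA e1 mulmxA Y2.
Qed.

Definition mpinv (C : numClosedFieldType) m n (B : 'M[C]_(m, n)) :
  'M[C]_(n, m) := xchoose (penrose_ex B).

Lemma mpinvP (C : numClosedFieldType) m n (B : 'M[C]_(m, n)) :
  penrose B (mpinv B).
Proof. exact: xchooseP. Qed.

Definition mpproj (C : numClosedFieldType) m n (B : 'M[C]_(m, n)) : 'M[C]_m :=
  B *m mpinv B.

(* Main.v *)
Require Import Defs.
From HB Require Import structures.
From mathcomp Require Import all_boot all_order all_algebra.
From mathcomp Require Import reals complex.
Import GRing.Theory.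
Local Open Scope ring_scope.

(** Put [M = W A W], let [P] be the orthogonal projector [mpproj ((A W)^q)]
    and [Y = (M P)^+].  Since [P] is Hermitian, [M P = M P P] says that the
    row space of [M P] lies in that of [P]; the column space of a
    Moore-Penrose inverse is the column space of the conjugate transpose, so
    [P Y = Y] ([mpinv_mul_proj]).  Hence [Y M Y = Y M (P Y) = Y (M P) Y = Y],
    which is the first equation; the other two hold trivially for [Y].
    Conversely, any solution [X] satisfies
    [X = (X W A) W X = Y W (A W X) = Y W A W Y = Y]: an outer inverse is
    determined by its two one-sided products. *)

Local Open Scope sesquilinear_scope.

Lemma mpproj_herm (C : numClosedFieldType) m n (B : 'M[C]_(m, n)) :
  (mpproj B)^t* = mpproj B.
Proof. by case/and4P: (mpinvP B) => _ _ /eqP. Qed.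

Lemma mpproj_idem (C : numClosedFieldType) m n (B : 'M[C]_(m, n)) :
  mpproj B *m mpproj B = mpproj B.
Proof.
by case/and4P: (mpinvP B) => /eqP BXB _ _ _; rewrite /mpproj mulmxA BXB.
Qed.

(** The factorisation [B^+ = B^* (B^+)^* B^+], a consequence of
    [B^+ B] being Hermitian, exhibits the columns of [B^+] inside the column
    space of [B^*], on which [P = P^*] acts as the identity when [B P = B]. *)
Lemma mpinv_mul_proj (C : numClosedFieldType) m n
    (B : 'M[C]_(m, n)) (P : 'M[C]_n) :
  P^t* = P -> B *m P = B -> P *m mpinv B = mpinv B.
Proof.
move=> hermP BP; case/and4P: (mpinvP B) => _ /eqP XBX _ /eqP hermXB.
have PB : P *m B^t* = B^t* by rewrite -{2}BP trmxC_mul hermP.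
by rewrite -{1}XBX -{1}hermXB trmxC_mul !mulmxA PB -trmxC_mul hermXB XBX.
Qed.

(** Compressing [M] by a Hermitian idempotent before inverting gives an outer
    inverse of [M] itself, as the missing factor [P] is absorbed on the left
    of the inverse. *)
Lemma mpinv_compress_outer (C : numClosedFieldType) m n
    (M : 'M[C]_(m, n)) (P : 'M[C]_n) :
  P^t* = P -> P *m P = P ->
  mpinv (M *m P) *m M *m mpinv (M *m P) = mpinv (M *m P).
Proof.
move=> hermP idemP; set Y := mpinv (M *m P).
have PY : P *m Y = Y by apply: mpinv_mul_proj; rewrite // -mulmxA idemP.
case/and4P: (mpinvP (M *m P)) => _ /eqP YMPY _ _.
by rewrite -{2}PY mulmxA -(mulmxA Y) YMPY.
Qed.

Local Close Scope sesquilinear_scope.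

Theorem theorem2p2 (R : realType) (m n : nat)
    (A : 'M[R[i]]_(m, n)) (W : 'M[R[i]]_(n, m)) (hW : W <> 0) (q : nat) :
  unique
    (fun X : 'M[R[i]]_(m, n) =>
       [/\ X *m W *m A *m W *m X = X,
           X *m W *m A
             = mpinv (W *m A *m W *m mpproj ((A *m W) ^+ q)) *m W *m A
         & A *m W *m X
             = A *m W *m mpinv (W *m A *m W *m mpproj ((A *m W) ^+ q))])
    (mpinv (W *m A *m W *m mpproj ((A *m W) ^+ q))).
Proof.
have outer := mpinv_compress_outer _ _ _ (W *m A *m W) _
  (mpproj_herm _ _ _ ((A *m W) ^+ q)) (mpproj_idem _ _ _ ((A *m W) ^+ q)).
move: (mpinv _) outer => Y; rewrite !mulmxA => outer.
split=> [|X [XX XWA AWX]]; first by split.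
by rewrite -XX XWA -!mulmxA (mulmxA A) AWX !mulmxA outer.
Qed.
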